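(* Let $(M,F)$ be a Finsler manifold with metric tensor $g$, $\mathbf B$ a $\pi$-form (of degree one) independent of the directional argument $y$, $\overline A$ the $\pi$-vector field with $i_{\overline A}\,g=\mathbf B$, $A^2:=g(\overline A,\overline A)$, $\mathfrak B:=\mathbf B(\overline\eta)$, and let $\widetilde F=\frac{\mathfrak B^2}{F}-F-\mathfrak B$ (with $\widetilde F\neq0$). Then the metric tensor $\widetilde g$ of $\widetilde F$ has maximal rank if and only if $$F^2(1-2A^2)+3\mathfrak B^2\neq0.$$
   Context: $\pi:TM\to M$ is the tangent bundle; $\pi$-vector fields are sections of the pullback bundle $\pi^{-1}(TM)$ and a $\pi$-form of degree one is a section of its dual; $\overline\eta(u)=(u,u)$ is the fundamental $\pi$-vector field, so $\mathfrak B(x,y)=\mathbf B_{(x,y)}(y)$. $\mathbf B$ is independent of $y$ if its vertical derivative vanishes, i.e. its components in natural coordinates depend on $x$ only. A Finsler metric $F:TM\to[0,\infty)$ is continuous, smooth and positive off the zero section, positively homogeneous of degree $1$ in $y$, with $\Omega=\frac12dd_JF^2$ of maximal rank ($J$ the vertical endomorphism of $TM$, $d_Jf=df\circ J$); its metric tensor on $\pi^{-1}(TM)$ is $g_{ij}=\frac12\frac{\partial^2F^2}{\partial y^i\partial y^j}$ (hence non-degenerate). Similarly $\widetilde g_{ij}=\frac12\frac{\partial^2\widetilde F^2}{\partial y^i\partial y^j}$, considered on the open conic subset of the slit tangent bundle where $\widetilde F\neq0$; maximal rank means non-degenerate. *)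

(* Defs.v *)
From HB Require Import structures.
From mathcomp Require Import all_boot all_order all_algebra.
From mathcomp Require Import all_classical all_reals all_analysis.

Set Implicit Arguments.
Unset Strict Implicit.
Unset Printing Implicit Defensive.

Import Order.TTheory GRing.Theory Num.Theory numFieldNormedType.Exports.
Local Open Scope classical_set_scope.
Local Open Scope ring_scope.

Section Smooth.
Variables (R : realType) (V W : normedModType R).

(* [U] is meant to be open, so that only the values of [f] on [U] matter. *)
Fixpoint Ck (k : nat) (U : set V) (f : V -> W) : Prop :=
  if k is k'.+1 then
    (forall x, U x -> differentiable f x) /\ (forall v, Ck k' U ('D_v f))
  else forall x, U x -> {for x, continuous f}.

Definition smooth (U : set V) (f : V -> W) : Prop := forall k, Ck k U f.

End Smooth.

Lemma diff_near_comp (R : realType) (U V W : normedModType R) (f : U -> V)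
    (g : V -> W) (h : U -> W) x y v : f x = y ->
  differentiable f x -> differentiable g y -> differentiable h x ->
  (\near x, h x = g (f x)) -> 'd h x v = 'd g y ('d f x v).
Proof.
move=> <- df dg dh hgf; have dgf := differentiable_comp df dg.
rewrite -[RHS]/(('d g (f x) \o 'd f x) v) -(diff_comp df dg).
by rewrite -(deriveE v dh) -(deriveE v dgf); exact: near_eq_derive.
Qed.

(* An atlas need not be maximal.  [psi a] is the inverse of the chart [phi a];
   the values of [phi a] outside [dom a], and of [psi a] outside
   [phi a @` dom a], are junk. *)
Record manifold (R : realType) (n : nat) := Manifold {
  carrier :> topologicalType;
  atlas : Type;
  dom : atlas -> set carrier;
  phi : atlas -> carrier -> 'rV[R]_n;
  psi : atlas -> 'rV[R]_n -> carrier;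
  manifold_hausdorff : hausdorff_space carrier;
  manifold_second_countable : @second_countable carrier;
  dom_open : forall a, open (dom a);
  dom_cover : forall p, exists a, dom a p;
  img_open : forall a, open (phi a @` dom a);
  phiK : forall a p, dom a p -> psi a (phi a p) = p;
  phi_continuous : forall a p, dom a p -> {for p, continuous (phi a)};
  psi_continuous : forall a u,
    (phi a @` dom a) u -> {for u, continuous (psi a)};
  transition_smooth : forall a b,
    smooth (phi a @` (dom a `&` dom b)) (phi b \o psi a) }.

Section Tangent.
Variables (R : realType) (n : nat) (M : manifold R n).
Implicit Types (a b c : atlas M) (p : M).

(* A tangent vector at [p] is the family of its components in the charts
   around [p], related by the Jacobians of the chart changes.  The components
   in the charts that do not contain [p] are normalised to 0. *)
Definition tangent_family p (v : atlas M -> 'rV[R]_n) : Prop :=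
  (forall a, ~ dom a p -> v a = 0) /\
  (forall a b, dom a p -> dom b p ->
     v b = 'd (phi b \o psi a) (phi a p) (v a)).

Definition tangent_pred p : {pred (atlas M -> 'rV[R]_n)} :=
  [pred v | `[< tangent_family p v >]].

Lemma tangent_predP p v : reflect (tangent_family p v) (v \in tangent_pred p).
Proof. by rewrite inE; exact: asboolP. Qed.

Fact tangent_submod_closed p : submod_closed (tangent_pred p).
Proof.
split=> [|k u v].
  by apply/tangent_predP; split=> // a b _ _; rewrite linear0.
have E c : (k *: u + v) c = k *: u c + v c by [].
move=> /tangent_predP[u0 uE] /tangent_predP[v0 vE].
apply/tangent_predP; split=> [a pa|a b pa pb].
  by rewrite E u0 // v0 // scaler0 addr0.
by rewrite !E linearP -uE // -vE.
Qed.

HB.instance Definition _ p :=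
  GRing.isSubmodClosed.Build R (atlas M -> 'rV[R]_n) (tangent_pred p)
    (tangent_submod_closed p).

Record tangent p := Tangent {
  tangent_val :> atlas M -> 'rV[R]_n;
  tangent_valP : tangent_val \in tangent_pred p }.

HB.instance Definition _ p := [isSub for @tangent_val p].
HB.instance Definition _ p := [Choice of tangent p by <:].
HB.instance Definition _ p := [SubChoice_isSubZmodule of tangent p by <:].
HB.instance Definition _ p := [SubZmodule_isSubLmodule of tangent p by <:].

Definition tcoord a p (y : tangent p) : 'rV[R]_n := tangent_val y a.

Lemma transition_differentiable a b p : dom a p -> dom b p ->
  differentiable (phi b \o psi a) (phi a p).
Proof. by move=> pa pb; apply: (transition_smooth a b 1).1; exists p. Qed.

Lemma near_transition a b p : dom a p -> dom b p ->
  \forall u \near phi a p, dom a (psi a u) /\ dom b (psi a u).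
Proof.
move=> pa pb; have ip : (phi a @` dom a) (phi a p) by exists p.
near=> u; split.
  have [q qa <-] : (phi a @` dom a) u.
    by near: u; apply: open_nbhs_nbhs; split=> //; exact: img_open a.
  by rewrite phiK.
near: u; apply: (psi_continuous ip).
by rewrite phiK //; apply: open_nbhs_nbhs; split=> //; exact: dom_open b.
Unshelve. all: by end_near. Qed.

Lemma transition_diff_comp a b c p v : dom a p -> dom b p -> dom c p ->
  'd (phi c \o psi a) (phi a p) v =
  'd (phi c \o psi b) (phi b p) ('d (phi b \o psi a) (phi a p) v).
Proof.
move=> pa pb pc; apply: diff_near_comp.
- by rewrite /= phiK.
- exact: transition_differentiable.
- exact: transition_differentiable.
- exact: transition_differentiable.
near=> u => /=.
have [_ ub] : dom a (psi a u) /\ dom b (psi a u).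
  by near: u; exact: near_transition.
by rewrite phiK.
Unshelve. all: by end_near. Qed.

Lemma transition_diff_id a p v : dom a p ->
  'd (phi a \o psi a) (phi a p) v = v.
Proof.
move=> pa; apply: etrans (esym (deriveE v (transition_differentiable pa pa))) _.
rewrite (@near_eq_derive _ _ _ _ id) ?derive_id //.
have ip : (phi a @` dom a) (phi a p) by exists p.
near=> u => /=.
have [q qa <-] : (phi a @` dom a) u.
  by near: u; apply: open_nbhs_nbhs; split=> //; exact: img_open a.
by rewrite phiK.
Unshelve. all: by end_near. Qed.

Definition tvec_family a p (v : 'rV[R]_n) : atlas M -> 'rV[R]_n := fun b =>
  if `[< dom a p /\ dom b p >] then 'd (phi b \o psi a) (phi a p) v else 0.

Fact tvec_familyP a p v : tvec_family a p v \in tangent_pred p.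
Proof.
apply/tangent_predP; split=> [b pb|b c pb pc]; rewrite /tvec_family.
  by case: asboolP => // -[].
case: asboolP => [[pa _]|npa]; last first.
  by case: asboolP => [[pa _]|_]; [case: npa | rewrite linear0].
case: asboolP => [_|[]//]; exact: transition_diff_comp.
Qed.

(* The tangent vector at [p] with components [v] in the chart [a]
   (0 if [a] is not a chart around [p]). *)
Definition tvec a p v : tangent p := Tangent (tvec_familyP a p v).

Lemma tvecK a p : dom a p -> cancel (@tvec a p) (@tcoord a p).
Proof.
move=> pa v; rewrite /tcoord /= /tvec_family asboolT //.
exact: transition_diff_id.
Qed.

Lemma tcoordK a p : dom a p -> cancel (@tcoord a p) (@tvec a p).
Proof.
move=> pa y; apply/val_inj/funext => b /=; rewrite /tvec_family.
have /tangent_predP[y0 yE] := tangent_valP y.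
case: asboolP => [[_ pb]|npb]; first by rewrite /tcoord -yE.
by rewrite y0 // => pb; apply: npb.
Qed.

End Tangent.

Section NaturalCoordinates.
Variables (R : realType) (n : nat) (M : manifold R n).
Implicit Types (a : atlas M) (p : M).

(* A function [f] on TM is given by its restrictions to the fibres;
   [local_rep a f] is [f] in the natural coordinates (x, y) induced by [a]. *)
Definition local_rep (W : Type) a (f : forall p, tangent p -> W)
    (z : 'rV[R]_n * 'rV[R]_n) : W :=
  f (psi a z.1) (tvec a (psi a z.1) z.2).

Definition TM_image a : set ('rV[R]_n * 'rV[R]_n) :=
  [set z | (phi a @` dom a) z.1].

Definition slit_image a : set ('rV[R]_n * 'rV[R]_n) :=
  [set z | (phi a @` dom a) z.1 /\ z.2 != 0].

Definition natural_coord a p (y : tangent p) : 'rV[R]_n * 'rV[R]_n :=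
  (phi a p, tcoord a y).

Definition basis_vec (i : 'I_n) : 'rV[R]_n := delta_mx 0 i.

End NaturalCoordinates.

Section TwoForm.
Variables (R : realType) (n : nat).
Local Notation V := ('rV[R]_n * 'rV[R]_n)%type.

(* d/dx^i |-> d/dy^i, d/dy^i |-> 0 *)
Definition vertical_endo (X : V) : V := (0, X.1).

Definition dJ (f : V -> R) : V -> V -> R := fun z X => 'D_(vertical_endo X) f z.

(* The bracket term vanishes, [X] and [Y] being constant fields. *)
Definition ext_deriv (theta : V -> V -> R) : V -> V -> V -> R := fun z X Y =>
  'D_X (fun z' => theta z' Y) z - 'D_Y (fun z' => theta z' X) z.

Definition Omega (F : V -> R) : V -> V -> V -> R := fun z X Y =>
  2^-1 * ext_deriv (dJ (fun z' => F z' ^+ 2)) z X Y.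

Definition nondegenerate (w : V -> V -> R) : Prop :=
  forall X, (forall Y, w X Y = 0) -> X = 0.

End TwoForm.

Section Finsler.
Variables (R : realType) (n : nat) (M : manifold R n).
Implicit Types (a : atlas M) (p : M).

Record finsler (F : forall p : M, tangent p -> R) : Prop := Finsler {
  finsler_ge0 : forall p (y : tangent p), 0 <= F p y;
  finsler_gt0 : forall p (y : tangent p), y != 0 -> 0 < F p y;
  finsler_continuous : forall a z, TM_image a z ->
    {for z, continuous (local_rep a F : _ -> R^o)};
  finsler_smooth : forall a,
    smooth (slit_image a) (local_rep a F : _ -> R^o);
  finsler_homogeneous : forall p (y : tangent p) (k : R), 0 < k ->
    F p (k *: y) = k * F p y;
  finsler_max_rank : forall a z, slit_image a z ->
    nondegenerate (Omega (local_rep a F) z) }.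

Definition metric_tensor (F : forall p : M, tangent p -> R) a p (y : tangent p)
    : 'M[R]_n :=
  \matrix_(i, j) (2^-1 *
    'D_(0, basis_vec R i) ('D_(0, basis_vec R j) (fun z => local_rep a F z ^+ 2 : R^o))
      (natural_coord a y)).

(* Defined on all of TM, but only its values on the slit tangent bundle are
   ever used. *)
Definition pi_field := forall p : M, tangent p -> tangent p.

Definition smooth_pi_field (X : pi_field) : Prop :=
  forall a, smooth (slit_image a) (local_rep a (fun p y => tcoord a (X p y))).

Definition pi_form := forall p : M, tangent p -> {linear tangent p -> R^o}.

Definition form_coord (B : pi_form) a p (y : tangent p) : 'rV[R]_n :=
  \row_j B p y (tvec a p (basis_vec R j)).

Definition smooth_pi_form (B : pi_form) : Prop :=
  forall a, smooth (TM_image a) (local_rep a (@form_coord B a)).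

(* vanishing of the vertical derivative *)
Definition direction_independent (B : pi_form) : Prop :=
  forall a z (w : 'rV[R]_n), TM_image a z ->
    'D_(0, w) (local_rep a (@form_coord B a)) z = 0.

(* i_X g = B, i.e. X^i g_ij = B_j *)
Definition metric_dual (F : forall p : M, tangent p -> R) (X : pi_field)
    (B : pi_form) : Prop :=
  forall a p (y : tangent p), dom a p -> y != 0 ->
    tcoord a (X p y) *m metric_tensor F a y = form_coord B a y.

(* g(X, X) = X^i g_ij X^j *)
Definition sqnorm (F : forall p : M, tangent p -> R) (X : pi_field)
    a p (y : tangent p) : R :=
  (tcoord a (X p y) *m metric_tensor F a y *m (tcoord a (X p y))^T) 0 0.

(* B evaluated at the fundamental field (p, y) |-> y *)
Definition form_eta (B : pi_form) p (y : tangent p) : R := B p y y.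

Definition Ftilde (F : forall p : M, tangent p -> R) (B : pi_form)
    p (y : tangent p) : R :=
  form_eta B y ^+ 2 / F p y - F p y - form_eta B y.

Definition Ftilde_dom (F : forall p : M, tangent p -> R) (B : pi_form)
    p (y : tangent p) : Prop :=
  y != 0 /\ Ftilde F B y != 0.

End Finsler.

(* Main.v *)
Require Import Defs.
From HB Require Import structures.
From mathcomp Require Import all_boot all_order all_algebra.
From mathcomp Require Import all_classical all_reals all_analysis.
From mathcomp Require Import ring.
Import Order.TTheory GRing.Theory Num.Theory numFieldNormedType.Exports.
Local Open Scope ring_scope.

Set Implicit Arguments.
Unset Strict Implicit.
Unset Printing Implicit Defensive.

(* In a chart, write ell and H for the vertical gradient and Hessian of F,
   b for B(y), m = B - (b/F) ell, c = -(1 + b^2/F^2), and F~ for the deformed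
   metric, with vertical gradient ell~.  Then
     g = F H + ell^T ell,   g~ = F~ (c H + (2/F) m^T m) + ell~^T ell~.
   Homogeneity gives y H = 0 and H y^T = 0, so that w = A - (b/F^2) y
   satisfies w H = m/F, and
     y g~ = F~ ell~,   w g~ = (F~/F) D m + (w . ell~) ell~,   D = c + 2 w . m,
   where F^2 (1 - 2 A^2) + 3 b^2 = - F^2 D.  If D = 0, some w - t y is a
   nonzero vector of the left kernel of g~.  If D <> 0, a vector u of the right
   kernel is orthogonal to ell~ (pair with y) and to m (pair with w), so it is
   killed by H and is a multiple of y; as y . ell~ = F~ <> 0, u = 0.  Using the
   left kernel in one direction and the right one in the other makes the
   symmetry of H unnecessary. *)

(** * Scalar products of row vectors and rank-one matrices *)

Section Dot.
Variables (R : comNzRingType) (n : nat).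
Implicit Types (u v w : 'rV[R]_n) (X : 'M[R]_n).

Definition dot u v : R := (u *m v^T) 0 0.

Lemma dotE u v : dot u v = \sum_i u 0 i * v 0 i.
Proof. by rewrite /dot mxE; apply: eq_bigr => i _; rewrite mxE. Qed.

Lemma dotC u v : dot u v = dot v u.
Proof. by rewrite !dotE; apply: eq_bigr => i _; rewrite mulrC. Qed.

Lemma dotDl u v w : dot (u + v) w = dot u w + dot v w.
Proof. by rewrite /dot mulmxDl mxE. Qed.

Lemma dotZl k u w : dot (k *: u) w = k * dot u w.
Proof. by rewrite /dot -scalemxAl mxE. Qed.

Lemma dotDr u v w : dot w (u + v) = dot w u + dot w v.
Proof. by rewrite dotC dotDl !(dotC w). Qed.

Lemma dotZr k u w : dot w (k *: u) = k * dot w u.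
Proof. by rewrite dotC dotZl dotC. Qed.

Lemma dot0l w : dot 0 w = 0.
Proof. by rewrite /dot mul0mx mxE. Qed.

Lemma mulmx_rank1 u v w : u *m (v^T *m w) = dot u v *: w.
Proof. by rewrite mulmxA [u *m _]mx11_scalar mul_scalar_mx. Qed.

Lemma dot_mulmx_tr X u v : dot (u *m X^T) v = dot u (v *m X).
Proof. by rewrite /dot trmx_mul mulmxA. Qed.

End Dot.

(** * Linear algebra at one tangent vector: when the deformed metric is invertible *)

Section Degeneracy.
Variables (R : realFieldType) (n : nat) (f b : R).
Variables (y ell beta A : 'rV[R]_n) (H : 'M[R]_n).
Hypotheses (f_neq0 : f != 0) (yH : y *m H = 0) (yHt : y *m H^T = 0).
Hypotheses (y_ell : dot y ell = f) (y_beta : dot y beta = b).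

Let g : 'M[R]_n := f *: H + ell^T *m ell.
Hypotheses (g_unit : g \in unitmx) (Ag : A *m g = beta).

(** In the notation of the overview, [ft] is F~, [pt] is ell~ and [gt] is g~; [pt] is what
    differentiating b^2/f - f - b gives when b has vertical gradient [beta]. *)
Let ft := b ^+ 2 / f - f - b.
Let c := - (b ^+ 2 / f ^+ 2 + 1).
Let m := beta - (b / f) *: ell.
Let pt := (2 * b / f - 1) *: beta + c *: ell.
Let gt : 'M[R]_n := ft *: (c *: H + (2 / f) *: (m^T *m m)) + pt^T *m pt.
Hypothesis ft_neq0 : ft != 0.

(** The projection of A along y onto the kernel of ell: A . ell = b/f and y . ell = f force the
    coefficient b/f^2. *)
Let w := A - (b / f ^+ 2) *: y.

(** A square plus 1 is positive; the order of the field enters here. *)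
Let c_neq0 : c != 0.
Proof. by rewrite oppr_eq0 gt_eqF// ltr_wpDl// divr_ge0 ?sqr_ge0. Qed.

Let y_m : dot y m = 0.
Proof. rewrite /m -scaleNr dotDr dotZr y_ell y_beta; by field. Qed.

Let y_pt : dot y pt = ft.
Proof. rewrite /pt dotDr !dotZr y_ell y_beta /ft /c; by field. Qed.

(** Computes g(A, y) in two ways: A g = beta gives b, and y g^T = f ell gives f (A . ell). *)
Let A_ell : dot A ell = b / f.
Proof.
have yg : y *m g^T = f *: ell.
  rewrite linearD linearZ /= trmx_mul trmxK mulmxDr -scalemxAr yHt scaler0.
  by rewrite add0r mulmx_rank1 y_ell.
have : dot A (y *m g^T) = b by rewrite -dot_mulmx_tr trmxK Ag dotC.
by rewrite yg dotZr => <-; field.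
Qed.

Let w_ell : dot w ell = 0.
Proof. rewrite /w -scaleNr dotDl dotZl y_ell A_ell; by field. Qed.

Let w_m : dot w m = dot beta A - b ^+ 2 / f ^+ 2.
Proof.
rewrite {1}/w -scaleNr dotDl dotZl y_m mulr0 addr0 /m -scaleNr dotDr dotZr.
rewrite A_ell (dotC A); by field.
Qed.

(** As w . ell = 0, the rank-one part of g drops out and w g = f (w H); on the other hand w g = beta
    - (b/f^2) f ell = m. *)
Let wH : w *m H = f^-1 *: m.
Proof.
have yg : y *m g = f *: ell.
  by rewrite mulmxDr -scalemxAr yH scaler0 add0r mulmx_rank1 y_ell.
have wg : w *m g = m.
  rewrite mulmxBl Ag -scalemxAl yg scalerA /m; congr (_ - _ *: _); by field.
move: wg; rewrite mulmxDr -scalemxAr mulmx_rank1 w_ell scale0r addr0 => <-.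
by rewrite scalerA mulVf// scale1r.
Qed.

Let y_gt : y *m gt = ft *: pt.
Proof.
rewrite mulmxDr -scalemxAr mulmxDr -!scalemxAr yH !mulmx_rank1 y_m y_pt.
by rewrite scale0r !scaler0 addr0 scaler0 add0r.
Qed.

Let D := c + 2 * dot w m.

Let w_gt : w *m gt = (ft / f * D) *: m + dot w pt *: pt.
Proof.
rewrite mulmxDr -scalemxAr mulmxDr -!scalemxAr wH !mulmx_rank1 !scalerA.
rewrite -scalerDl scalerA; congr (_ *: _ + _); rewrite /D; by field.
Qed.

(** Here beta . A is A^2, because A g = beta. *)
Let D_eq : f ^+ 2 * (1 - 2 * dot beta A) + 3 * b ^+ 2 = - f ^+ 2 * D.
Proof. rewrite /D w_m /c; by field. Qed.

Lemma deformed_metric_unit :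
  (gt \in unitmx) = (f ^+ 2 * (1 - 2 * dot beta A) + 3 * b ^+ 2 != 0).
Proof.
rewrite D_eq mulf_eq0 oppr_eq0 expf_eq0 (negPf f_neq0) /=.
apply/idP/idP => [gtU|D0].
  (* With D = 0 both w g~ and y g~ are multiples of ell~, and t is the ratio of their
     coefficients. *)
  apply/eqP => D0; pose t := dot w pt / ft.
  have : (w - t *: y) *m gt = 0.
    rewrite mulmxBl -scalemxAl y_gt w_gt D0 mulr0 scale0r add0r scalerA.
    by rewrite /t divfK// subrr.
  move=> /(congr1 (mulmx^~ (invmx gt))); rewrite mulmxK// mul0mx.
  move=> /eqP; rewrite subr_eq0 => /eqP wty.
  (* Pairing w = t y with ell gives 0 = t f, so t = 0. Then D reduces to c, which is nonzero. *)
  have w0 : w = 0.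
    have : t * f = 0 by rewrite -y_ell -dotZl -wty w_ell.
    move=> /eqP; rewrite mulf_eq0 (negPf f_neq0) orbF wty => /eqP->.
    exact: scale0r.
  move: D0; rewrite /D {1}w0 dot0l mulr0 addr0 => /eqP; exact/negP.
have tr_rank1 (v : 'rV[R]_n) : (v^T *m v)^T = v^T *m v.
  by rewrite trmx_mul trmxK.
(* Transposing makes u range over the right kernel of g~. *)
rewrite -unitmx_tr -row_free_unit; apply: inj_row_free => u ugt.
have u_pt : dot u pt = 0.
  have : dot u (y *m gt) = 0 by rewrite -dot_mulmx_tr ugt dot0l.
  by rewrite y_gt dotZr => /eqP; rewrite mulf_eq0 (negPf ft_neq0) => /eqP.
have u_m : dot u m = 0.
  have : dot u (w *m gt) = 0 by rewrite -dot_mulmx_tr ugt dot0l.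
  rewrite w_gt dotDr !dotZr u_pt mulr0 addr0 => /eqP.
  rewrite !mulf_eq0 invr_eq0 (negPf ft_neq0) (negPf f_neq0) (negPf D0).
  by move=> /eqP.
have uH : u *m H^T = 0.
  have gtE : gt^T = ft *: (c *: H^T + (2 / f) *: (m^T *m m)) + pt^T *m pt.
    rewrite -[in RHS](tr_rank1 m) -[in RHS](tr_rank1 pt).
    by apply/matrixP => i j; rewrite ![in RHS]mxE !mxE.
  move: ugt; rewrite gtE mulmxDr -!scalemxAr mulmxDr -!scalemxAr !mulmx_rank1.
  rewrite u_pt u_m !scale0r scaler0 !addr0 scalerA => /eqP.
  by rewrite scaler_eq0 mulf_eq0 (negPf ft_neq0) (negPf c_neq0) => /eqP.
(* Chosen so that u - k y is orthogonal to ell; being also killed by H^T, it is killed by g^T and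
   hence is 0. *)
pose k := dot u ell / f.
have : (u - k *: y) *m g^T = 0.
  have -> : g^T = f *: H^T + ell^T *m ell.
    rewrite -[in RHS](tr_rank1 ell).
    by apply/matrixP => i j; rewrite ![in RHS]mxE !mxE.
  rewrite mulmxDr -scalemxAr mulmx_rank1 mulmxBl uH -scalemxAl yHt.
  rewrite scaler0 subr0 scaler0 add0r.
  by rewrite -scaleNr dotDl dotZl y_ell /k mulNr divfK// subrr scale0r.
move=> /(congr1 (mulmx^~ (invmx g^T))); rewrite mulmxK ?unitmx_tr// mul0mx.
move=> /eqP; rewrite subr_eq0 => /eqP uky.
move: u_pt; rewrite uky dotZl y_pt => /eqP.
by rewrite mulf_eq0 (negPf ft_neq0) orbF => /eqP->; rewrite scale0r.
Qed.

End Degeneracy.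

(** * First and second directional derivatives of F^2 and of the deformed function *)

Section DirectionalDerivatives.
Local Open Scope classical_set_scope.
Variables (R : realType) (V : normedModType R) (U : set V).
Hypothesis U_open : open U.
Implicit Types (f b : V -> R) (z u v : V).

Lemma near_open z : U z -> \forall x \near z, U x.
Proof. by move=> Uz; apply: open_nbhs_nbhs. Qed.

Lemma is_derive_inv f z v : f z != 0 -> derivable f z v ->
  is_derive z v (fun x => (f x)^-1) (- (f z) ^- 2 * 'D_v f z).
Proof.
move=> fz df; apply: DeriveDef; first exact: derivableV.
by rewrite deriveV.
Qed.

Lemma derive_sqr f z v : derivable f z v ->
  'D_v (fun x => f x ^+ 2) z = 2 * f z * 'D_v f z.
Proof. by move=> df; exact: (deriveX 2 df). Qed.

Lemma derive2_sqr f z u v : U z -> (forall x, U x -> derivable f x v) ->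
  derivable f z u -> derivable ('D_v f) z u ->
  'D_u ('D_v (fun x => f x ^+ 2)) z =
    2 * (f z * 'D_u ('D_v f) z + 'D_u f z * 'D_v f z).
Proof.
move=> Uz fv fu /derivableP fvu.
have /derivableP fu' := fu.
(* The outer derivative only sees the inner one near z, and U is a neighbourhood of z on which the
   first-order formula holds. *)
rewrite (@near_eq_derive _ _ _ _ (2 *: (f * 'D_v f))); last first.
  near=> x; rewrite derive_sqr; first by rewrite !fctE /= -mulrA.
  by apply: fv; near: x; exact: near_open.
rewrite derive_val /=.
rewrite -[_ *: _]/(2 * _) -[f z *: _]/(f z * _) -['D_v f z *: _]/('D_v f z * _).
by rewrite (mulrC ('D_v f z)).
Unshelve. all: by end_near. Qed.

Lemma is_derive_deformed f b z v : f z != 0 -> derivable f z v ->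
  derivable b z v ->
  is_derive z v (fun x => b x ^+ 2 / f x - f x - b x)
    ((2 * b z / f z - 1) * 'D_v b z - (b z ^+ 2 / f z ^+ 2 + 1) * 'D_v f z).
Proof.
move=> fz df db; have /derivableP df' := df; have /derivableP db' := db.
(* With these facts in the context, instance resolution differentiates the whole expression. *)
have dV := is_derive_inv fz df.
apply: (@is_derive_eq _ _ _ (b ^+ 2 * (fun x => (f x)^-1) - f - b)).
rewrite !fctE /=.
rewrite -![_ *: _]/(_ * _).
by field.
Qed.

(** Since b has no second derivative in these directions, differentiating the two coefficients of
    the first derivative leaves the common factor b_u - (b/f) f_u. The resulting product is the
    source of the term m^T m. *)
Lemma derive2_deformed f b z u v : U z -> (forall x, U x -> f x != 0) ->
  (forall x, U x -> derivable f x v) -> (forall x, U x -> derivable b x v) ->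
  derivable f z u -> derivable b z u -> derivable ('D_v f) z u ->
  derivable ('D_v b) z u -> 'D_u ('D_v b) z = 0 ->
  is_derive z u ('D_v (fun x => b x ^+ 2 / f x - f x - b x))
    (- (b z ^+ 2 / f z ^+ 2 + 1) * 'D_u ('D_v f) z +
     2 / f z * ('D_u b z - b z / f z * 'D_u f z) *
               ('D_v b z - b z / f z * 'D_v f z)).
Proof.
move=> Uz f0 fv bv fu bu /derivableP fvu /derivableP bvu buv0.
have dV := is_derive_inv (f0 _ Uz) fu; have fz := f0 _ Uz.
have /derivableP fu' := fu; have /derivableP bu' := bu.
pose iv := fun x => (f x)^-1.
apply: (@near_eq_is_derive _ _ _
  ((2 *: (b * iv) - cst 1) * 'D_v b - (b ^+ 2 * (iv ^+ 2) + cst 1) * 'D_v f)).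
  near=> x; have Ux : U x by near: x; exact: near_open.
  have [_ ->] := is_derive_deformed (f0 _ Ux) (fv _ Ux) (bv _ Ux).
  rewrite !fctE /= /iv -![_ *: _]/(_ * _); field; exact: f0.
apply: is_derive_eq; rewrite !fctE /= buv0.
rewrite -![_ *: _]/(_ * _) /iv.
by field.
Unshelve. all: by end_near. Qed.

(** The difference quotient is constant for small nonzero h. This serves the fibre coordinates and,
    along rays, homogeneous functions, without a chain rule. *)
Lemma is_derive_affine (W : normedModType R) (f : V -> W) z v (l : W) :
  (\forall h \near (0 : R), f (h *: v + z) = f z + h *: l) ->
  is_derive z v f l.
Proof.
move=> fz; have cvl : h^-1 *: (f (h *: v + z) - f z) @[h --> 0^'] --> l.
  apply: cvg_near_cst.
  near=> h => /=; have h0 : h != 0 by near: h; exact: nbhs_dnbhs_neq.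
  rewrite (_ : f (h *: v + z) = f z + h *: l); last first.
    by near: h; exact: nbhs_dnbhs.
  by rewrite addrC addKr scalerA mulVf// scale1r.
by apply: DeriveDef; [exact: cvgP cvl | exact: cvg_lim cvl].
Unshelve. all: by end_near. Qed.

End DirectionalDerivatives.

(** * Natural coordinates on the slit tangent bundle *)

Section Charts.
Local Open Scope classical_set_scope.
Variables (R : realType) (n : nat) (M : manifold R n).
Implicit Types (a : atlas M) (p : M).

Lemma open_slit_image a : open (slit_image a).
Proof.
have -> : slit_image a = TM_image a `&` snd @^-1` (~` [set 0]).
  by apply/seteqP; split=> z [za /eqP z2]; split=> //; exact/eqP.
apply: openI.
  apply: open_comp => [z _|]; [exact: cvg_fst | exact: img_open].
apply: open_comp => [z _|]; first exact: cvg_snd.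
exact/closed_openC/accessible_closed_set1/hausdorff_accessible/norm_hausdorff.
Qed.

Lemma local_rep_natural_coord (W : Type) a p (y : tangent p)
    (G : forall p, tangent p -> W) : dom a p ->
  local_rep a G (natural_coord a y) = G p y.
Proof.
move=> pa; rewrite /local_rep /natural_coord /= -[in RHS](tcoordK pa y).
by rewrite phiK.
Qed.

Lemma slit_image_natural_coord a p (y : tangent p) :
  dom a p -> y != 0 -> slit_image a (natural_coord a y).
Proof.
move=> pa y0; split=> /=; first by exists p.
apply: contra_neq y0 => yc0; rewrite -(tcoordK pa y) yc0.
apply/val_inj/funext => b /=; rewrite /tvec_family.
by case: asboolP => // _; rewrite linear0.
Qed.

(** Valid at every p: where the chart does not apply, the components are the default 0, which is
    linear too. *)
Lemma tvec_linear a p : linear (@tvec _ _ M a p).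
Proof.
move=> k u v; apply/val_inj/funext => b.
rewrite [RHS](_ : _ = k *: tvec_family a p u b + tvec_family a p v b) //=.
rewrite /tvec_family; case: asboolP => _; first by rewrite linearP.
by rewrite scaler0 addr0.
Qed.

HB.instance Definition _ a p := GRing.isLinear.Build R 'rV[R]_n (tangent p)
  *:%R (@tvec R n M a p) (@tvec_linear a p).

Lemma tvec_slit_neq0 a z : slit_image a z ->
  tvec a (psi a z.1) z.2 != 0 :> tangent (psi a z.1).
Proof.
move=> [[p pa <-] z2]; rewrite phiK//.
by apply: contra_neq z2 => tz; rewrite -(tvecK pa z.2) tz.
Qed.

End Charts.
Arguments open_slit_image {R n M} a.

(** * Vertical gradient and Hessian; Euler's relations *)

Section VerticalCalculus.
Local Open Scope classical_set_scope.
Variables (R : realType) (n : nat).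
Local Notation V := ('rV[R]_n * 'rV[R]_n)%type.
Implicit Types (z : V) (w u : 'rV[R]_n) (f : V -> R) (U : set V).

Definition vgrad f z : 'rV[R]_n := \row_j 'D_(0, basis_vec R j) f z.

Definition vhess f z : 'M[R]_n :=
  \matrix_(i, j) 'D_(0, basis_vec R i) ('D_(0, basis_vec R j) f) z.

Let vertE w : (0, w) = \sum_j w 0 j *: (0, basis_vec R j) :> V.
Proof.
have D u v : (0, u + v) = (0, u) + (0, v) :> V.
  by rewrite -[RHS]/(0 + 0, _) addr0.
rewrite {1}(row_sum_delta w) (big_morph (fun u => (0, u) : V) D erefl).
by apply: eq_bigr => j _; rewrite -[RHS]/(_ *: 0, _) scaler0.
Qed.

Lemma derive_vert f z w : differentiable f z ->
  'D_(0, w) f z = dot w (vgrad f z).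
Proof.
move=> df; rewrite deriveE// dotE vertE linear_sum.
by apply: eq_bigr => j _; rewrite linearZ mxE -deriveE.
Qed.

Lemma derive2_vert U f z u w : open U -> U z ->
  (forall x, U x -> differentiable f x) ->
  (forall v x, U x -> differentiable ('D_v f) x) ->
  'D_(0, u) ('D_(0, w) f) z = dot (u *m vhess f z) w.
Proof.
move=> Uo Uz df ddf.
rewrite (@near_eq_derive _ _ _ _
  (\sum_j w 0 j *: 'D_(0, basis_vec R j) f)); last first.
  near=> x; rewrite derive_vert; last first.
    by apply: df; near: x; exact: (near_open Uo Uz).
  by rewrite dotE fct_sumE; apply: eq_bigr => j _; rewrite mxE.
rewrite derive_sum => [|j]; last exact/derivableZ/diff_derivable/ddf.
rewrite dotE; apply: eq_bigr => j _.
rewrite deriveZ; last exact/diff_derivable/ddf.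
rewrite derive_vert; last exact: ddf.
rewrite [RHS]mulrC; congr (_ * _).
by rewrite dotE mxE; apply: eq_bigr => i _; rewrite !mxE.
Unshelve. all: by end_near. Qed.

Lemma derive_coord z w j : is_derive z (0, w) (fun x : V => x.2 0 j) (w 0 j).
Proof. by apply: is_derive_affine; near=> h; rewrite /= !mxE addrC.
Unshelve. all: by end_near. Qed.

Section Homogeneous.
Variables (U : set V) (f : V -> R).
Hypotheses (U_open : open U) (df : forall x, U x -> differentiable f x).
Hypothesis ddf : forall v x, U x -> differentiable ('D_v f) x.
Hypothesis U_cone : forall x v k, 0 < k -> U (x, v) -> U (x, k *: v).
Hypothesis f_hom : forall x v k, 0 < k -> f (x, k *: v) = k * f (x, v).
Variable z : V.
Hypothesis Uz : U z.

Let near_scale : \forall h \near (0 : R), 0 < 1 + h.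
Proof.
near=> h; rewrite -ltrBlDl sub0r.
by near: h; apply: lt_nbhsr; rewrite oppr_lt0.
Unshelve. all: by end_near. Qed.

Let scaleE h : h *: (0, z.2) + z = (z.1, (1 + h) *: z.2) :> V.
Proof.
rewrite {2}(surjective_pairing z) -[LHS]/(h *: 0 + z.1, h *: z.2 + z.2).
by rewrite scaler0 add0r scalerDl scale1r addrC.
Qed.

(** On the ray through y, homogeneity reads f((1 + h) y) = f(y) + h f(y) as soon as 1 + h > 0, so f
    is affine there. *)
Lemma euler_vgrad : dot z.2 (vgrad f z) = f z.
Proof.
rewrite -derive_vert; last exact: df.
suff : is_derive z (0, z.2) f (f z) by case.
apply: is_derive_affine; near=> h; rewrite scaleE f_hom; last first.
  by near: h; exact: near_scale.
by rewrite -surjective_pairing mulrDl mul1r.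
Unshelve. all: by end_near. Qed.

(** Differentiating f(x, k y) = k f(x, y) along w multiplies the direction by k on the left and the
    value by k on the right. *)
Let derive_hom0 w k : 0 < k -> 'D_(0, w) f (z.1, k *: z.2) = 'D_(0, w) f z.
Proof.
move=> k0; have Uzk : U (z.1, k *: z.2).
  by apply: U_cone => //; rewrite -surjective_pairing.
have kn0 : k != 0 by rewrite gt_eqF.
apply: (mulfI kn0).
rewrite -[k * 'D_(0, w) f z]/(k *: _) -deriveZ; last exact/diff_derivable/df.
have -> : k * 'D_(0, w) f (z.1, k *: z.2) = 'D_(0, k *: w) f (z.1, k *: z.2).
  by rewrite !derive_vert ?dotZl//; exact: df.
(* The two difference quotients already agree for each h. *)
rewrite /derive; apply: (congr1 (fun g : R -> R => lim (g @ 0^'))).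
apply/funext => h /=.
have fk x : f (x.1, k *: x.2) = k * f x by rewrite f_hom// -surjective_pairing.
rewrite fk (_ : h *: _ + _ = ((h *: (0, w) + z).1, k *: (h *: (0, w) + z).2)).
  by rewrite fk.
rewrite -[LHS]/(h *: 0 + z.1, h *: (k *: w) + k *: z.2).
by rewrite /= scalerDr !scalerA [h * k]mulrC.
Qed.

(** First vertical derivatives, being homogeneous of degree 0, are constant along the ray through
    y. *)
Lemma vhess_eta : z.2 *m vhess f z = 0.
Proof.
apply/rowP => j; rewrite [RHS]mxE.
have := derive_vert z.2 (ddf (0, basis_vec R j) Uz).
rewrite dotE mxE => DE.
transitivity ('D_(0, z.2) ('D_(0, basis_vec R j) f) z).
  by rewrite DE; apply: eq_bigr => i _; rewrite !mxE.
suff : is_derive z (0, z.2) ('D_(0, basis_vec R j) f) 0 by case.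
apply: is_derive_affine; near=> h.
by rewrite scaleE derive_hom0 ?scaler0 ?addr0//; near: h; exact: near_scale.
Unshelve. all: by end_near. Qed.

End Homogeneous.

(** Differentiating Euler's relation y . grad f = f along the i-th fibre direction produces the i-th
    partial derivative on both sides; cancelling it leaves the sum of y^j H_ij. This replaces the
    symmetry of second derivatives. *)
Lemma vhess_eta_tr U f z : open U -> U z ->
  (forall x, U x -> differentiable f x) ->
  (forall v x, U x -> differentiable ('D_v f) x) ->
  (forall x, U x -> dot x.2 (vgrad f x) = f x) ->
  z.2 *m (vhess f z)^T = 0.
Proof.
move=> Uo Uz df ddf euler; apply/rowP => i; rewrite [RHS]mxE.
pose e : V := (0, basis_vec R i).
have : 'D_e f z = \sum_j (z.2 0 j * 'D_e ('D_(0, basis_vec R j) f) z +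
                         'D_(0, basis_vec R j) f z * basis_vec R i 0 j).
  rewrite (@near_eq_derive _ _ _ _ (\sum_j
    (fun x : V => x.2 0 j) * 'D_(0, basis_vec R j) f)); last first.
    near=> x; rewrite -euler; last by near: x; exact: (near_open Uo Uz).
    by rewrite dotE fct_sumE; apply: eq_bigr => j _; rewrite !mxE.
  have D j : is_derive z e ((fun x : V => x.2 0 j) * 'D_(0, basis_vec R j) f)
     (z.2 0 j * 'D_e ('D_(0, basis_vec R j) f) z +
                         'D_(0, basis_vec R j) f z * basis_vec R i 0 j).
    have /derivableP d2 : derivable ('D_(0, basis_vec R j) f) z e.
      exact/diff_derivable/ddf.
    have d1 := derive_coord z (basis_vec R i) j.
    exact: is_deriveM.
  by have [_ ->] := is_derive_sum D.
rewrite big_split /= (_ : \sum_j 'D_(0, basis_vec R j) f z * _ = 'D_e f z).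
  move=> /(congr1 (fun x => x - 'D_e f z)); rewrite addrK subrr => ->.
  by rewrite mxE; apply: eq_bigr => j _; rewrite !mxE.
rewrite (derive_vert (basis_vec R i) (df _ Uz)) dotE.
by apply: eq_bigr => j _; rewrite mulrC [vgrad f z 0 j]mxE.
Unshelve. all: by end_near. Qed.

End VerticalCalculus.

(** * The Finsler function and its metric in a chart *)

Section FinslerCharts.
Local Open Scope classical_set_scope.
Variables (R : realType) (n : nat) (M : manifold R n).
Variables (F : forall p : M, tangent p -> R) (hF : finsler F).
Variable a : atlas M.
Local Notation V := ('rV[R]_n * 'rV[R]_n)%type.
Let f : V -> R := local_rep a F.

Lemma finsler_local_gt0 z : slit_image a z -> 0 < f z.
Proof. by move=> sz; exact/(finsler_gt0 hF)/tvec_slit_neq0. Qed.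

Lemma finsler_local_hom (x v : 'rV[R]_n) k :
  0 < k -> f (x, k *: v) = k * f (x, v).
Proof.
move=> k0; rewrite /f /local_rep /= -(finsler_homogeneous hF) //.
by rewrite linearZ.
Qed.

Lemma slit_image_cone (x v : 'rV[R]_n) (k : R) : 0 < k ->
  slit_image a (x, v) -> slit_image a (x, k *: v).
Proof.
by move=> k0 [/= xa v0]; split=> //=; rewrite scaler_eq0 gt_eqF.
Qed.

Lemma finsler_local_diff z : slit_image a z -> differentiable f z.
Proof. by case: (finsler_smooth hF a 1) => + _; exact. Qed.

Lemma finsler_local_diff2 v z : slit_image a z -> differentiable ('D_v f) z.
Proof. by case: (finsler_smooth hF a 2) => _ /(_ v)[+ _]; exact. Qed.

Lemma finsler_euler z : slit_image a z -> dot z.2 (vgrad f z) = f z.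
Proof.
exact: (euler_vgrad finsler_local_diff finsler_local_hom).
Qed.

Lemma finsler_vhess_eta z : slit_image a z -> z.2 *m vhess f z = 0.
Proof.
exact: (vhess_eta finsler_local_diff finsler_local_diff2 slit_image_cone
  finsler_local_hom).
Qed.

Lemma finsler_vhess_eta_tr z : slit_image a z -> z.2 *m (vhess f z)^T = 0.
Proof.
move=> sz; apply: (vhess_eta_tr (open_slit_image a) sz finsler_local_diff
  finsler_local_diff2 finsler_euler).
Qed.

Lemma metric_tensor_finsler p (y : tangent p) : dom a p -> y != 0 ->
  let z := natural_coord a y in
  metric_tensor F a y = f z *: vhess f z + (vgrad f z)^T *m vgrad f z.
Proof.
move=> pa y0 z; have sz := slit_image_natural_coord pa y0.
apply/matrixP => i j; rewrite !mxE big_ord1 !mxE.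
rewrite (derive2_sqr (open_slit_image a) sz); first by rewrite mulKf ?pnatr_eq0.
- by move=> x sx; exact/diff_derivable/finsler_local_diff.
- exact/diff_derivable/finsler_local_diff.
- exact/diff_derivable/finsler_local_diff2.
Qed.

(** On a vertical vector, Omega((0, v), (Y1, Y2)) = g(v, Y1), so a left kernel vector v of g makes
    (0, v) degenerate for Omega. *)
Lemma metric_tensor_finsler_unit p (y : tangent p) : dom a p -> y != 0 ->
  metric_tensor F a y \in unitmx.
Proof.
move=> pa y0; have sz := slit_image_natural_coord pa y0.
rewrite -row_free_unit; apply: inj_row_free => v vg.
suff : (0, v) = 0 :> V by case.
apply: (finsler_max_rank hF sz) => -[Y1 Y2]; rewrite /Omega /ext_deriv /dJ /=.
(* The vertical endomorphism kills (0, v), so the second term of the exterior derivative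
   vanishes. *)
rewrite (_ : (fun z' => 'D_(vertical_endo (0, v)) _ z') = cst 0); last first.
  by apply/funext => x; rewrite derive0.
rewrite derive_cst subr0 /vertical_endo /=.
rewrite (derive2_sqr (open_slit_image a) sz); first last.
- exact/diff_derivable/finsler_local_diff2.
- exact/diff_derivable/finsler_local_diff.
- by move=> x sx; exact/diff_derivable/finsler_local_diff.
rewrite (derive2_vert v Y1 (open_slit_image a) sz finsler_local_diff
  finsler_local_diff2).
rewrite !(derive_vert _ (finsler_local_diff sz)).
suff : dot (v *m metric_tensor F a y) Y1 = 0.
  rewrite metric_tensor_finsler// mulmxDr -scalemxAr mulmx_rank1 dotDl !dotZl.
  by rewrite (dotC (vgrad _ _) Y1) => ->; rewrite !mulr0.
by rewrite vg dot0l.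
Qed.

End FinslerCharts.

(** * Vertical derivatives of B evaluated at the fundamental field *)

Section FormCharts.
Local Open Scope classical_set_scope.
Variables (R : realType) (n : nat) (M : manifold R n) (B : pi_form M).
Hypotheses (hB : smooth_pi_form B) (hBy : direction_independent B).
Variable a : atlas M.
Local Notation V := ('rV[R]_n * 'rV[R]_n)%type.
Let beta : V -> 'rV[R]_n := local_rep a (@form_coord R n M B a).
Let b : V -> R := local_rep a (@form_eta R n M B).

Lemma form_eta_local z : b z = dot z.2 (beta z).
Proof.
rewrite /b /beta /local_rep /form_eta.
set p := psi a z.1; set y := tvec a p z.2.
have yE : y = \sum_j z.2 0 j *: tvec a p (basis_vec R j).
  rewrite /y {1}(row_sum_delta z.2) linear_sum.
  by apply: eq_bigr => j _; rewrite linearZ.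
rewrite {2}yE linear_sum dotE.
by apply: eq_bigr => j _; rewrite linearZ mxE.
Qed.

Let is_derive_beta z w j : TM_image a z ->
  is_derive z (0, w) (fun x => beta x 0 j) 0.
Proof.
move=> za; have dB : derivable beta z (0, w).
  by apply: diff_derivable; case: (hB a 1) => + _; exact.
apply: DeriveDef; first by move/derivable_mxP: dB; exact.
have /matrixP/(_ 0 j) := derive_mx dB.
by rewrite mxE => <-; rewrite (hBy w za) mxE.
Qed.

(** In the sum of y^j beta_j the coefficients beta_j have zero vertical derivative, so the product
    rule differentiates only the y^j. *)
Lemma is_derive_form_eta z w : TM_image a z ->
  is_derive z (0, w) b (dot w (beta z)).
Proof.
move=> za.
have -> : b = \sum_j (fun x : V => x.2 0 j) * (fun x : V => beta x 0 j).
  by apply/funext => x; rewrite form_eta_local dotE fct_sumE.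
have D j : is_derive z (0, w)
    ((fun x : V => x.2 0 j) * (fun x : V => beta x 0 j)) (w 0 j * beta z 0 j).
  have d1 := derive_coord z w j; have d2 := is_derive_beta w j za.
  by apply: is_derive_eq; rewrite scaler0 add0r [RHS]mulrC.
by rewrite dotE; exact: is_derive_sum.
Qed.

(** Near z the first derivative is the combination of the beta_j with constant coefficients w^j. *)
Lemma is_derive2_form_eta z u w : slit_image a z ->
  is_derive z (0, u) ('D_(0, w) b) 0.
Proof.
move=> sz.
apply: (@near_eq_is_derive _ _ _
  (\sum_j w 0 j *: (fun x : V => beta x 0 j) : V -> R)).
  near=> x; have [xa _] : slit_image a x.
    by near: x; exact: (near_open (open_slit_image a) sz).
  by have [_ ->] := is_derive_form_eta w xa; rewrite dotE fct_sumE.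
have D j : is_derive z (0, u) (w 0 j *: (fun x : V => beta x 0 j)) 0.
  have d2 := is_derive_beta u j sz.1.
  by apply: is_derive_eq; rewrite scaler0.
by apply: (is_derive_eq (is_derive_sum D)); rewrite big1.
Unshelve. all: by end_near. Qed.

End FormCharts.

(** * The metric of the deformed function *)

Section Deformation.
Local Open Scope classical_set_scope.
Variables (R : realType) (n : nat) (M : manifold R n).
Variables (F : forall p : M, tangent p -> R) (hF : finsler F).
Variables (B : pi_form M) (hB : smooth_pi_form B).
Hypothesis hBy : direction_independent B.
Variable a : atlas M.

(** Half the Hessian of F~^2 is F~ times the Hessian of F~ plus ell~^T ell~; the right-hand side is
    arranged to match [gt] in the algebraic part. *)
Lemma metric_tensor_Ftilde p (y : tangent p) : dom a p -> y != 0 ->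
  let z := natural_coord a y in let f := local_rep a F in
  let ell := vgrad f z in let beta := form_coord B a y in
  let fz := F y in let b := form_eta B y in
  metric_tensor (@Ftilde R n M F B) a y =
  (b ^+ 2 / fz - fz - b) *:
    (- (b ^+ 2 / fz ^+ 2 + 1) *: vhess f z +
     (2 / fz) *: ((beta - (b / fz) *: ell)^T *m (beta - (b / fz) *: ell))) +
  ((2 * b / fz - 1) *: beta + - (b ^+ 2 / fz ^+ 2 + 1) *: ell)^T *m
  ((2 * b / fz - 1) *: beta + - (b ^+ 2 / fz ^+ 2 + 1) *: ell).
Proof.
move=> pa y0 z f ell beta fz b; have sz := slit_image_natural_coord pa y0.
have fzE : fz = f z by rewrite /f local_rep_natural_coord.
pose bl := local_rep a (@form_eta R n M B).
have bE : b = bl z by rewrite /bl local_rep_natural_coord.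
have betaE : beta = local_rep a (@form_coord R n M B a) z.
  by rewrite local_rep_natural_coord.
have f0 x : slit_image a x -> f x != 0.
  by move=> sx; rewrite gt_eqF// (finsler_local_gt0 hF).
have df v x : slit_image a x -> derivable f x v.
  by move=> sx; exact/diff_derivable/(finsler_local_diff hF).
have db w x : slit_image a x -> derivable bl x (0, w).
  by move=> [xa _]; have [] := is_derive_form_eta hB hBy w xa.
have D1 w := is_derive_deformed (f0 _ sz) (df (0, w) _ sz) (db w _ sz).
have D1' w x (sx : slit_image a x) :=
  is_derive_deformed (f0 _ sx) (df (0, w) _ sx) (db w _ sx).
have D2 u w := derive2_deformed (open_slit_image a) sz f0 (df (0, w))
  (db w) (df (0, u) _ sz) (db u _ sz)
  (diff_derivable (finsler_local_diff2 hF (0, w) sz))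
  (@ex_derive _ _ _ _ _ _ _ (is_derive2_form_eta hB hBy u w sz))
  (@derive_val _ _ _ _ _ _ _ (is_derive2_form_eta hB hBy u w sz)).
have Db j : 'D_(0, basis_vec R j) bl z = beta 0 j.
  have [_ ->] := is_derive_form_eta hB hBy (basis_vec R j) sz.1.
  rewrite betaE dotE (bigD1 j)//= big1 ?addr0 => [|k kj].
    by rewrite mxE !eqxx mul1r.
  by rewrite mxE (negPf kj) andbF mul0r.
apply/matrixP => i j; rewrite [LHS]mxE.
rewrite (_ : local_rep a (@Ftilde R n M F B) =
  fun x => bl x ^+ 2 / f x - f x - bl x)//.
rewrite (derive2_sqr (open_slit_image a) sz); first last.
- by have [] := D2 (basis_vec R i) (basis_vec R j).
- by have [] := D1 (basis_vec R i).
- by move=> x sx; have [] := D1' (basis_vec R j) x sx.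
have [_ ->] := D2 (basis_vec R i) (basis_vec R j).
have [_ ->] := D1 (basis_vec R i); have [_ ->] := D1 (basis_vec R j).
rewrite !Db fzE bE ![in RHS]mxE !big_ord1 ![in RHS]mxE.
rewrite mulKf ?pnatr_eq0// ![beta 0 _]mxE -/z.
by ring.
Qed.

Lemma Ftilde_metric_unit (A : pi_field M) (hAB : metric_dual F A B)
    p (y : tangent p) : dom a p -> Ftilde_dom F B y ->
  (metric_tensor (@Ftilde R n M F B) a y \in unitmx) =
  (F y ^+ 2 * (1 - 2 * sqnorm F A a y) + 3 * form_eta B y ^+ 2 != 0).
Proof.
move=> pa [y0 ft0]; have sz := slit_image_natural_coord pa y0.
have fE : F y = local_rep a F (natural_coord a y).
  by rewrite local_rep_natural_coord.
have gE := metric_tensor_finsler hF pa y0.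
have gU := metric_tensor_finsler_unit hF pa y0.
rewrite metric_tensor_Ftilde//.
(* Replacing A g by beta turns A^2 into the product beta . A of the algebraic criterion. *)
rewrite /sqnorm (hAB a p y pa y0).
apply: (deformed_metric_unit (y := tcoord a y)).
- by rewrite gt_eqF// (finsler_gt0 hF).
- exact: (finsler_vhess_eta hF sz).
- exact: (finsler_vhess_eta_tr hF sz).
- by rewrite fE; exact: (finsler_euler hF sz).
- have := form_eta_local B a (natural_coord a y).
  by rewrite !local_rep_natural_coord.
- by rewrite fE -gE.
- by rewrite fE -gE; exact: hAB.
- exact: ft0.
Qed.

End Deformation.

Theorem theorem3p8 (R : realType) (n : nat) (M : manifold R n)
    (F : forall p : M, tangent p -> R) (hF : finsler F)
    (B : pi_form M) (hB : smooth_pi_form B) (hBy : direction_independent B)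
    (A : pi_field M) (hA : smooth_pi_field A) (hAB : metric_dual F A B) :
  (forall (a : atlas M) (p : M) (y : tangent p),
     dom a p -> Ftilde_dom F B y ->
     (\rank (metric_tensor (@Ftilde R n M F B) a y) = n <->
      F p y ^+ 2 * (1 - 2 * sqnorm F A a y) + 3 * form_eta B y ^+ 2 <> 0)) /\
  ((forall (a : atlas M) (p : M) (y : tangent p),
      dom a p -> Ftilde_dom F B y ->
      \rank (metric_tensor (@Ftilde R n M F B) a y) = n) <->
   (forall (a : atlas M) (p : M) (y : tangent p),
      dom a p -> Ftilde_dom F B y ->
      F p y ^+ 2 * (1 - 2 * sqnorm F A a y) + 3 * form_eta B y ^+ 2 <> 0)).
Proof.
(* The equivalence holds at each single vector; the global one follows by quantifying both sides. *)
have pointwise a p (y : tangent p) : dom a p -> Ftilde_dom F B y ->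
    \rank (metric_tensor (@Ftilde R n M F B) a y) = n <->
    F p y ^+ 2 * (1 - 2 * sqnorm F A a y) + 3 * form_eta B y ^+ 2 <> 0.
  move=> pa dy; have gtU := Ftilde_metric_unit hF hB hBy hAB pa dy.
  have rankE : (\rank (metric_tensor (@Ftilde R n M F B) a y) == n) =
      (F p y ^+ 2 * (1 - 2 * sqnorm F A a y) + 3 * form_eta B y ^+ 2 != 0).
    by rewrite -gtU -row_free_unit.
  by split=> /eqP; [rewrite rankE | rewrite -rankE] => /eqP.
split=> //; split=> G a p y pa dy.
  by apply: (pointwise a p y pa dy).1; exact: G.
by apply: (pointwise a p y pa dy).2; exact: G.
Qed.
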